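(* Let $z \in \mathbb{R}$ be algebraic of degree $\le 2$ and let $0 < \alpha < 1$. Then the Kronecker sequence $(\{nz\})_{n\in\mathbb{N}}$ fulfills neither Obstruction 1 nor Obstruction 2 for $\alpha$. That is, for every strictly increasing sequence $N_1 < N_2 < \cdots$ of positive integers such that, for some fixed $s$, the set $\{\{nz\} : 1 \le n \le N_i\}$ has exactly $s$ different gap lengths for every $i$, and such that each of these gap lengths is $\alpha$-small, $\alpha$-intermediate or $\alpha$-large, neither Obstruction 1 nor Obstruction 2 holds.
   Context: $\{x\} := x-\lfloor x\rfloor$ is the fractional part. Gap lengths of a finite set of points in $[0,1)$ are the distances between adjacent points when the set is placed on the circle $\mathbb{R}/\mathbb{Z}$ of length $1$ (including the arc passing through $0$; a single point has one gap, of length $1$). Let $N_1<N_2<\cdots$ be such that the set of points $x_1,\ldots,x_{N_i}$ of a sequence has exactly $s$ different gap lengths $L_1^{(i)} < L_2^{(i)} < \cdots < L_s^{(i)}$ for every $i$. For $0<\alpha\le 1$ the $j$-th gap length is called - $\alpha$-small if $\lim_{i\to\infty} N_i^\alpha L_j^{(i)} = 0$; - $\alpha$-intermediate if there are constants $K_1,K_2>0$ with $K_1/N_i^\alpha \le L_j^{(i)} \le K_2/N_i^\alpha$ for all $i \in \mathbb{N}$; - $\alpha$-large if $\lim_{i\to\infty} N_i^\alpha L_j^{(i)} = \infty$. The $\alpha$-small gap lengths are those with indices $j=1,\ldots,w_1$ for some $w_1$, the $\alpha$-intermediate ones follow, and then the $\alpha$-large ones. Obstruction 1 (for $\alpha$):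 there exists an $\alpha$-intermediate gap length. Obstruction 2 (for $\alpha$): there is an $\alpha$-small gap length and the largest $\alpha$-small gap length is also $1$-small, i.e. $N_i L_{w_1}^{(i)} \to 0$ as $i\to\infty$. *)

(* Defs.v *)
From HB Require Import structures.
From mathcomp Require Import all_boot all_order all_algebra.
From mathcomp Require Import all_classical all_reals all_analysis.

Set Implicit Arguments.
Unset Strict Implicit.
Unset Printing Implicit Defensive.

Import Order.TTheory GRing.Theory Num.Theory.
Import numFieldNormedType.Exports.

Local Open Scope classical_set_scope.
Local Open Scope ring_scope.

(* [p] is the minimal polynomial of [z] over the rationals, so [d] is its
   degree ([size p] is the degree plus one). *)
Definition algebraic_of_degree (R : realType) (z : R) (d : nat) : Prop :=
  exists p : {poly rat},
    [/\ p \is monic, irreducible_poly p, size p = d.+1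
      & root (map_poly (ratr : rat -> R) p) z].

Definition frac_part (R : realType) (x : R) : R := x - (Num.floor x)%:~R.

Definition kronecker (R : realType) (z : R) : nat -> R :=
  fun n => frac_part (n%:R * z).

(* Consecutive differences along the increasing enumeration of the set of
   entries of [pts] (points of [0, 1)).  Appending the smallest point
   shifted by 1 yields the arc through 0, and the gap 1 for a single point. *)
Definition circle_gaps (R : realType) (pts : seq R) : seq R :=
  if sort <=%R (undup pts) is x :: t
  then pairmap (fun a b => b - a) x (rcons t (x + 1))
  else [::].

(* The different gap lengths of {x 1, ..., x n}, in increasing order. *)
Definition gap_lengths (R : realType) (x : nat -> R) (n : nat) : seq R :=
  sort <=%R (undup (circle_gaps [seq x k | k <- iota 1 n])).

(* Gap lengths are numbered from 0: [gap_length x n j] is the (j+1)-st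
   smallest one, meaningful for [j < size (gap_lengths x n)]. *)
Definition gap_length (R : realType) (x : nat -> R) (n j : nat) : R :=
  nth 0 (gap_lengths x n) j.

Section Obstructions.
Variables (R : realType) (x : nat -> R) (N : nat -> nat).
Implicit Types (alpha : R) (j s : nat).

Definition gap_small alpha j : Prop :=
  (N i)%:R `^ alpha * gap_length x (N i) j @[i --> \oo] --> (0 : R).

Definition gap_intermediate alpha j : Prop :=
  exists K1 K2 : R, [/\ 0 < K1, 0 < K2 &
    forall i, K1 / (N i)%:R `^ alpha <= gap_length x (N i) j
              /\ gap_length x (N i) j <= K2 / (N i)%:R `^ alpha].

Definition gap_large alpha j : Prop :=
  (N i)%:R `^ alpha * gap_length x (N i) j @[i --> \oo] --> +oo.

Definition obstruction1 alpha s : Prop :=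
  exists2 j, (j < s)%N & gap_intermediate alpha j.

(* [w] is the index of the largest alpha-small gap length. *)
Definition obstruction2 alpha s : Prop :=
  exists w, [/\ (w < s)%N, gap_small alpha w,
    forall j, (j < s)%N -> gap_small alpha j -> (j <= w)%N
    & gap_small 1 w].

End Obstructions.

(* Main.v *)
Require Import Defs.
From HB Require Import structures.
From mathcomp Require Import all_boot all_order all_algebra.
From mathcomp Require Import all_classical all_reals all_analysis.
From mathcomp Require Import ring lra zify.

Import Order.TTheory GRing.Theory Num.Theory.
Import numFieldNormedType.Exports.

Local Open Scope classical_set_scope.
Local Open Scope ring_scope.

(** All gaps of the first [n] points are of exact order [1 / n] when [z] is a
    quadratic irrational, and bounded below by a constant when [z] is rational.
    So no gap length can be of order [n ^ - alpha], and none can be [o(1 / n)].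

    If [z] is rational, the points lie in finitely many positions and the gaps
    are bounded below by a constant.  If [z] is quadratic irrational, it is
    badly approximable: [`|m * z - l| >= c / `|m|] for integers [m != 0] and [l]
    ([quadratic_badly_approximable], the case of degree two of Liouville's
    inequality).  A gap is the difference of two points modulo 1, hence of the
    form [m * z - l] with [`|m| <= n], so it is at least [c / n].

    The upper bound [C / n] follows without describing all gaps.  Dirichlet's
    theorem gives [p / q] in lowest terms with [q <= n] and
    [`|q * z - p| <= 1 / n], and bad approximability forces [q] to be at least
    [c * n].  The numbers [j * (p / q)], [1 <= j <= q], run modulo 1 through all
    multiples of [1 / q], and [j * z] is within [1 / n] of [j * (p / q)]; so
    the points meet every interval of length [C / n]
    ([kronecker_relatively_dense]).  In particular they meet the interval of
    this length just after the left end of a gap.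

    The bounds are put together in [kronecker_gap_bounds].  In both cases
    [n * gap >= c], which excludes 1-small gap lengths.  An intermediate gap
    length would make [n ^ alpha] bounded in the rational case, and
    [n ^ (1 - alpha)] bounded in the quadratic one. *)

(** * Diophantine approximation of numbers of degree at most two *)

Lemma intr_norm_ge1 {R : realType} (m : int) :
  m != 0 -> 1 <= `|m%:~R : R|.
Proof.
by move=> m0; rewrite -intr_norm (ler_int R 1) -gtz0_ge1 normr_gt0.
Qed.

(** The numbers [m * (a / q) - l] are multiples of [1 / q]. *)
Lemma rational_gap {R : realType} (a q : int) :
  q != 0 -> exists2 c : R, 0 < c & forall m l : int,
    m%:~R * (a%:~R / q%:~R) - l%:~R != 0 :> R ->
    c <= `|m%:~R * (a%:~R / q%:~R) - l%:~R|.
Proof.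
move=> q0; have q0R : (q%:~R : R) != 0 by rewrite intr_eq0.
exists `|q%:~R|^-1; first by rewrite invr_gt0 normr_gt0.
move=> m l.
have -> : m%:~R * (a%:~R / q%:~R) - l%:~R = (m * a - l * q)%:~R / q%:~R :> R.
  by rewrite intrD intrN !intrM; field.
rewrite mulf_eq0 negb_or intr_eq0 normrM normfV => /andP[ml0 _].
by rewrite ler_peMl ?invr_ge0// intr_norm_ge1.
Qed.

(** Liouville's argument: the form [A l^2 + B l m + C m^2] is a nonzero integer,
    so at least 1 in absolute value, but is also [m * z - l] times a factor
    of size [O(n)] as soon as [`|m * z - l| < 1].  The form has no zeros with
    [m != 0] exactly when the quadratic polynomial has no rational root. *)
Lemma quadratic_badly_approximable {R : realType} (z : R) (A B C : int) :
  A%:~R * z ^+ 2 + B%:~R * z + C%:~R = 0 ->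
  (forall l m : int, m != 0 -> A * l ^+ 2 + B * l * m + C * m ^+ 2 != 0) ->
  exists2 c : R, 0 < c & forall (n : nat) (m l : int),
    m != 0 -> (`|m| <= n)%N -> c / n%:R <= `|m%:~R * z - l%:~R|.
Proof.
move=> zroot Fneq0.
(* [K * n] bounds the factor when [`|m * z - l| < 1]; the summand 1 gives
   [K >= 1], which settles the case [`|m * z - l| >= 1]. *)
pose K : R := `|A%:~R| * (1 + 2 * `|z|) + `|B%:~R| + 1.
have K1 : 1 <= K.
  rewrite /K lerDr addr_ge0// mulr_ge0// addr_ge0// mulr_ge0//.
have K0 : 0 < K by apply: lt_le_trans K1.
exists K^-1; first by rewrite invr_gt0.
move=> n m l m0 mn.
have n1 : 1 <= n%:R :> R by rewrite ler1n; move: m0 mn; lia.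
have n0 : 0 < n%:R :> R by apply: lt_le_trans n1.
have mnR : `|m%:~R : R| <= n%:R.
  by rewrite -intr_norm -[n%:R]/(n%:~R) ler_int; lia.
set e := m%:~R * z - l%:~R.
have Kn0 : 0 < K * n%:R by rewrite mulr_gt0.
rewrite -invfM -div1r ler_pdivrMr//.
have [e1|e1] := leP 1 `|e|.
  by rewrite !mulr_ege1.
have /(@intr_norm_ge1 R) := Fneq0 l m m0.
(* The form minus [m ^+ 2] times the vanishing polynomial at [z] has [e] as a
   factor; the cofactor grows at most linearly in [n]. *)
have -> : (A * l ^+ 2 + B * l * m + C * m ^+ 2)%:~R =
    e * (A%:~R * (e - 2 * (m%:~R * z)) - B%:~R * m%:~R) :> R.
  have -> : (A * l ^+ 2 + B * l * m + C * m ^+ 2)%:~R =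
    A%:~R * l%:~R ^+ 2 + B%:~R * l%:~R * m%:~R + C%:~R * m%:~R ^+ 2 :> R.
    by rewrite !intrD !intrM.
  have -> : C%:~R = - (A%:~R * z ^+ 2 + B%:~R * z) :> R.
    by rewrite -[LHS]subr0 -zroot; ring.
  by rewrite /e; ring.
move=> /le_trans; apply; rewrite normrM ler_wpM2l//.
apply: le_trans (ler_normB _ _) _; rewrite !normrM.
have H1 : `|e - 2 * (m%:~R * z)| <= n%:R * (1 + 2 * `|z|).
  apply: le_trans (ler_normB _ _) _; rewrite !normrM ger0_norm// mulrDr mulr1.
  rewrite lerD//; first by apply: le_trans n1; apply: ltW.
  by rewrite mulrCA ler_wpM2r// mulr_ge0.
have H2 : `|A%:~R| * `|e - 2 * (m%:~R * z)|
    <= `|A%:~R| * (n%:R * (1 + 2 * `|z|)) by rewrite ler_wpM2l.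
have H3 : `|B%:~R| * `|m%:~R| <= `|B%:~R| * n%:R :> R by rewrite ler_wpM2l.
rewrite /K; lra.
Qed.

Lemma irreducible_root_size (F : fieldType) (p : {poly F}) (x : F) :
  irreducible_poly p -> root p x -> size p = 2%N.
Proof.
move=> [_ pirr]; rewrite -dvdp_XsubCl => /pirr.
by rewrite size_XsubC => /(_ isT) /eqp_size <-; rewrite size_XsubC.
Qed.

(** In degree two, irreducibility of the minimal polynomial excludes rational
    roots, hence zeros of the integral form obtained by clearing
    denominators. *)
Lemma algebraic_approximation {R : realType} (z : R) (d : nat) :
  algebraic_of_degree z d -> (d <= 2)%N ->
  (exists2 c : R, 0 < c & forall m l : int,
    m%:~R * z - l%:~R != 0 -> c <= `|m%:~R * z - l%:~R|) \/
  (exists2 c : R, 0 < c & forall (n : nat) (m l : int),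
    m != 0 -> (`|m| <= n)%N -> c / n%:R <= `|m%:~R * z - l%:~R|).
Proof.
move=> [p [pmon pirr psz]].
rewrite rootE horner_coef size_map_poly psz => + d2.
have plead : p`_d = 1.
  by move: pmon; rewrite monicE /lead_coef psz => /eqP.
have d0 : (0 < d)%N by case: pirr; rewrite psz.
have {d0 d2} [dE|dE] : d = 1%N \/ d = 2%N by lia.
  rewrite dE in plead *; rewrite !big_ord_recr big_ord0/= !coef_map plead /=.
  rewrite rmorph1 expr0 expr1 mulr1 mul1r add0r /ratr => /eqP zE; left.
  have -> : z = (- numq p`_0)%:~R / (denq p`_0)%:~R by rewrite intrN mulNr; lra.
  by apply: rational_gap; rewrite denq_eq0.
rewrite dE in psz plead *; rewrite !big_ord_recr big_ord0/= !coef_map plead /=.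
rewrite rmorph1 expr0 expr1 mulr1 mul1r add0r /ratr => /eqP zE; right.
have p0E := divq_num_den p`_0; have p1E := divq_num_den p`_1.
set a := numq p`_0 in zE p0E; set b := denq p`_0 in zE p0E.
set a' := numq p`_1 in zE p1E; set b' := denq p`_1 in zE p1E.
have b0 : b != 0 by rewrite denq_eq0.
have b'0 : b' != 0 by rewrite denq_eq0.
clearbody a b a' b'.
apply: (@quadratic_badly_approximable R z (b * b') (a' * b) (a * b')).
  have bR : b%:~R != 0 :> R by rewrite intr_eq0.
  have b'R : b'%:~R != 0 :> R by rewrite intr_eq0.
  rewrite !intrM.
  rewrite -[RHS](mulr0 (b%:~R * b'%:~R)) -zE; field.
  by rewrite b'R bR.
move=> l m m0; apply/eqP => F0.
suff /(irreducible_root_size _ _ _ pirr) : root p (l%:~R / m%:~R).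
  by rewrite psz.
rewrite rootE horner_coef psz !big_ord_recr big_ord0/= plead add0r -p0E -p1E.
have bQ : b%:~R != 0 :> rat by rewrite intr_eq0.
have b'Q : b'%:~R != 0 :> rat by rewrite intr_eq0.
have mQ : m%:~R != 0 :> rat by rewrite intr_eq0.
have {}F0 : (b * b' * l ^+ 2 + a' * b * l * m + a * b' * m ^+ 2)%:~R = 0 :> rat.
  by rewrite F0.
move: F0; rewrite !intrD !intrM => F0; apply/eqP.
rewrite -[RHS](mul0r (b%:~R * b'%:~R * m%:~R ^+ 2)^-1) -F0; field.
by rewrite bQ b'Q mQ.
Qed.

Lemma frac_part_itv {R : realType} (x : R) : 0 <= frac_part x < 1.
Proof.
have := floor_itv x; rewrite /frac_part intrD => /andP[h1 h2].
by apply/andP; split; lra.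
Qed.

(** Pigeonhole on the [n] boxes of length [1 / n] and the [n + 1] points
    [frac_part (k * z)], [k <= n]. *)
Lemma dirichlet {R : realType} (z : R) (n : nat) : (0 < n)%N ->
  exists q p : int, [/\ 0 < q, (`|q| <= n)%N & `|q%:~R * z - p%:~R| <= n%:R^-1].
Proof.
move=> n0; have n0R : 0 < n%:R :> R by rewrite ltr0n.
have boxP (k : 'I_n.+1) :
    (`|Num.floor (n%:R * frac_part (k%:R * z))| < n)%N.
  have /andP[f0 f1] := frac_part_itv (k%:R * z).
  have h0 : 0 <= Num.floor (n%:R * frac_part (k%:R * z)).
    by rewrite floor_ge0 mulr_ge0// ltW.
  have : Num.floor (n%:R * frac_part (k%:R * z)) < n.
    by rewrite floor_lt_int -[ltRHS]mulr1 ltr_pM2l.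
  by move: h0; lia.
pose box k := Ordinal (boxP k).
have /injectivePn[i [j ij]] : ~~ injectiveb box.
  by apply/negP => /injectiveP/leq_card; rewrite !card_ord ltnn.
wlog {ij} ij : i j / (i < j)%N => [wlg|].
  have [/wlg//|ji|/val_inj/eqP] := ltngtP i j; last by rewrite (negbTE ij).
  by move=> /esym; apply: wlg.
move=> /(congr1 val) /= boxE.
exists (j%:Z - i%:Z), (Num.floor (j%:R * z) - Num.floor (i%:R * z)).
split; [lia | have := ltn_ord j; lia |].
have -> : (j%:Z - i%:Z)%:~R * z -
    (Num.floor (j%:R * z) - Num.floor (i%:R * z))%:~R =
    frac_part (j%:R * z) - frac_part (i%:R * z).
  by rewrite /frac_part !intrB; ring.
move: boxE.
have /andP[fi0 fi1] := frac_part_itv (i%:R * z).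
have /andP[fj0 fj1] := frac_part_itv (j%:R * z).
set x := frac_part _ in fi0 fi1 *; set y := frac_part _ in fj0 fj1 *.
move=> boxE.
have {}boxE : Num.floor (n%:R * x) = Num.floor (n%:R * y).
  have : 0 <= Num.floor (n%:R * x) by rewrite floor_ge0 mulr_ge0// ltW.
  have : 0 <= Num.floor (n%:R * y) by rewrite floor_ge0 mulr_ge0// ltW.
  by move: boxE; lia.
have := floor_itv (n%:R * x); have := floor_itv (n%:R * y).
rewrite boxE intrD => /andP[y1 y2] /andP[x1 x2].
rewrite -[leRHS]mul1r ler_pdivlMr// -[X in _ * X]ger0_norm ?ler0n//.
by rewrite -normrM ler_norml; apply/andP; split; lra.
Qed.

(** Dividing [q] and [p] by their gcd only improves the approximation. *)
Lemma dirichlet_coprime {R : realType} (z : R) (n : nat) : (0 < n)%N ->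
  exists q p : int, [/\ 0 < q, (`|q| <= n)%N, coprimez p q
    & `|q%:~R * z - p%:~R| <= n%:R^-1].
Proof.
move=> n0; have [q [p [q0 qn qp]]] := dirichlet z n n0.
pose g := gcdz p q.
have g0 : 0 < g by rewrite lt_def gcdz_eq0 negb_and (gt_eqF q0) orbT.
have /dvdzP[q' qE] : (g %| q)%Z by apply: dvdz_gcdr.
have /dvdzP[p' pE] : (g %| p)%Z by apply: dvdz_gcdl.
exists q', p'; split.
- by move: q0; rewrite qE pmulr_lgt0.
- by apply: leq_trans qn; rewrite qE abszM leq_pmulr//; lia.
- have [u [v uvE]] := Bezoutz p q; apply/coprimezP; exists (u, v) => /=.
  apply: (mulIf (lt0r_neq0 g0)); rewrite mul1r -[RHS]uvE.
  by rewrite [in RHS]pE [in RHS]qE; ring.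
- apply: le_trans qp.
  rewrite qE pE !intrM.
  have -> : q'%:~R * g%:~R * z - p'%:~R * g%:~R =
      g%:~R * (q'%:~R * z - p'%:~R) :> R by ring.
  rewrite normrM ler_peMl// intr_norm_ge1//; exact: lt0r_neq0.
Qed.



(** The denominator [q] of a good approximation is comparable with [n], and the
    multiples of [p / q] are equidistant with step [1 / q] on the circle.  The
    constant [2 + c^-1] collects the error [1 / n] on both sides and the step
    [1 / q <= c^-1 / n]. *)
Lemma kronecker_relatively_dense {R : realType} (z c : R) :
  0 < c ->
  (forall (n : nat) (m l : int), m != 0 -> (`|m| <= n)%N ->
     c / n%:R <= `|m%:~R * z - l%:~R|) ->
  forall (n : nat) (x : R), (0 < n)%N -> exists (j : nat) (l : int),
    [/\ (0 < j)%N, (j <= n)%N, x < j%:R * z - l%:~R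
      & j%:R * z - l%:~R <= x + (2 + c^-1) / n%:R].
Proof.
move=> c0 zbad n x n0.
have n0R : 0 < n%:R :> R by rewrite ltr0n.
have [q [p [q0 qn copq zq]]] := dirichlet_coprime z n n0.
have q0R : 0 < q%:~R :> R by rewrite ltr0z.
have q0N : q%:~R != 0 :> R by rewrite gt_eqF.
have qabs : `|q|%N%:R = q%:~R :> R by rewrite -[LHS]/(`|q|%N%:Z%:~R) gtz0_abs.
have cq : q%:~R^-1 <= c^-1 / n%:R.
  rewrite ler_pdivlMl// -qabs; apply: le_trans zq.
  by apply: zbad; rewrite ?gt_eqF.
(* [t / q] is the first multiple of [1 / q] beyond [x + 1 / n]: an error
   of at most [1 / n] cannot bring it back to [x]. *)
pose t := Num.floor (q%:~R * (x + n%:R^-1)) + 1.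
have [t1 t2] : x + n%:R^-1 < t%:~R / q%:~R /\
    t%:~R / q%:~R <= x + n%:R^-1 + q%:~R^-1 :> R.
  have /andP[f1 f2] := floor_itv (q%:~R * (x + n%:R^-1)).
  rewrite ltr_pdivlMr// [_ * q%:~R]mulrC; split => //.
  rewrite ler_pdivrMr// mulrDl mulVf// mulrC intrD; lra.
have /coprimezP[[u v] /= uvE] := copq.
(* [j] is the solution of [j * p = t] modulo [q] in [1 .. q], as
   [u] is the inverse of [p] modulo [q]. *)
pose r := ((u * t - 1) %% q)%Z.
have r0 : 0 <= r by rewrite modz_ge0 ?gt_eqF.
have rq : r < q by rewrite ltz_pmod.
have rE : u * t - 1 = ((u * t - 1) %/ q)%Z * q + r := divz_eq _ _.
move: ((u * t - 1) %/ q)%Z r r0 rq rE => k r r0 rq rE.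
have [j jk] : exists j : nat, j%:Z = u * t - k * q by exists `|r|%N.+1; lia.
have j0 : (0 < j)%N by lia.
have jq : j%:R <= q%:~R :> R by rewrite -[leLHS]/(j%:Z%:~R) ler_int; lia.
have tE : t%:~R / q%:~R = j%:R * (p%:~R / q%:~R) + (v * t + k * p)%:~R :> R.
  rewrite -[j%:R]/(j%:Z%:~R) jk; apply: (mulIf q0N).
  rewrite mulrDl mulrA !mulfVK// -!intrM -intrD.
  by congr _%:~R; rewrite -[LHS]mul1r -uvE; ring.
have err : `|j%:R * z - j%:R * (p%:~R / q%:~R)| <= n%:R^-1.
  apply: le_trans zq.
  have -> : j%:R * z - j%:R * (p%:~R / q%:~R) =
      j%:R / q%:~R * (q%:~R * z - p%:~R) by field.
  rewrite normrM ler_piMl// ger0_norm; first by rewrite ler_pdivrMr// mul1r.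
  by rewrite divr_ge0// ltW.
move: err; rewrite ler_norml => /andP[err1 err2].
exists j, (- (v * t + k * p)); split=> //; first by move: qn; lia.
  by rewrite intrN; lra.
by rewrite intrN mulrDl; lra.
Qed.

(** * Gaps of a finite set on the circle *)

Lemma pairmap_sub_path {R : realType} (x g : R) (s : seq R) :
  path <%R x s -> g \in pairmap (fun a b => b - a) x s ->
  exists a b, [/\ g = b - a, a \in x :: s, b \in s, a < b
    & {in x :: s, forall y, a < y -> b <= y}].
Proof.
elim: s x => [//|y s IHs] x /= /andP[xy ys].
have ymin : {in s, forall w, y < w}.
  by apply/allP; apply: order_path_min ys; apply: lt_trans.
rewrite inE => /orP[/eqP ->|/(IHs _ ys)[a [b [-> ain bin ab next]]]].
  exists x, y; split; rewrite ?mem_head// => w.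
  by rewrite !inE => /or3P[/eqP->|/eqP->|/ymin/ltW//]; rewrite ?ltxx.
exists a, b; split=> //; first by rewrite in_cons ain orbT.
  by rewrite in_cons bin orbT.
move=> w; rewrite inE => /orP[/eqP->|]; last exact: next.
have ya : y <= a.
  by move: ain; rewrite inE => /orP[/eqP->//|/ymin/ltW].
by move=> ax; have := lt_trans xy (le_lt_trans ya ax); rewrite ltxx.
Qed.

(** The two alternatives for [b] are an inner gap and the arc through 0.  The
    last clause expresses adjacency on the circle, where [a] is followed by the
    points beyond it and then by all points shifted by 1. *)
Lemma circle_gapsP {R : realType} (pts : seq R) (g : R) :
  {in pts, forall y, 0 <= y < 1} -> g \in circle_gaps pts ->
  exists a b, [/\ g = b - a, a < b, a \in pts,
      b \in pts \/ (exists2 y, y \in pts & b = y + 1)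
    & {in pts, forall y, (a < y -> b <= y) /\ b <= y + 1}].
Proof.
move=> pts01; rewrite /circle_gaps.
have memE : sort <=%R (undup pts) =i pts.
  by move=> y; rewrite mem_sort mem_undup.
have : sorted <%R (sort <=%R (undup pts)) by rewrite sort_lt_sorted undup_uniq.
case: sort memE => [//|x t] memE /= xt.
have xmin : {in x :: t, forall w, x <= w}.
  move=> w; rewrite inE => /orP[/eqP->//|].
  have /allP := order_path_min lt_trans xt.
  by move=> /[apply]/ltW.
have x1max : {in x :: t, forall w, w < x + 1}.
  move=> w; rewrite memE => /pts01/andP[_ w1].
  have /pts01/andP[x0 _] : x \in pts by rewrite -memE mem_head.
  lra.
have path1 : path <%R x (rcons t (x + 1)).
  by rewrite rcons_path xt x1max// mem_last.
move=> /(pairmap_sub_path _ _ _ path1)[a [b [-> ain bin ab next]]].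
have bx1 : b <= x + 1.
  move: bin; rewrite mem_rcons inE => /orP[/eqP->//|bt].
  by apply/ltW/x1max; rewrite inE bt orbT.
exists a, b; split=> //.
- move: ain; rewrite -rcons_cons mem_rcons inE memE => /orP[/eqP ax|//].
  by have := lt_le_trans ab bx1; rewrite ax ltxx.
- move: bin; rewrite mem_rcons inE => /orP[/eqP->|bt]; [right|left].
    by exists x => //; rewrite -memE mem_head.
  by rewrite -memE inE bt orbT.
- move=> y yp; split; last by rewrite (le_trans bx1)// lerD2r xmin// memE.
  by apply: next; rewrite -rcons_cons mem_rcons inE memE yp orbT.
Qed.

(** [a] is the left end of an arc of the given length; by the last clause
    no integer translate of a point of the sequence falls inside that arc. *)
Lemma gap_kronecker {R : realType} (z : R) (n j : nat) :
  (j < size (gap_lengths (kronecker z) n))%N ->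
  exists a : R, [/\ 0 < gap_length (kronecker z) n j,
    exists m l : int, (`|m| <= n)%N /\
       gap_length (kronecker z) n j = m%:~R * z - l%:~R
  & forall (k : nat) (l : int), (0 < k)%N -> (k <= n)%N -> 
    a < k%:R * z - l%:~R ->
    gap_length (kronecker z) n j <= k%:R * z - l%:~R - a].
Proof.
move=> /(mem_nth 0); rewrite -/(gap_length _ _ _).
set g := gap_length _ _ _; rewrite /gap_lengths mem_sort mem_undup.
have ptsP y : y \in [seq kronecker z k | k <- iota 1 n] ->
    exists k : nat, [/\ (0 < k)%N, (k <= n)%N & y = frac_part (k%:R * z)].
  move=> /mapP[k]; rewrite mem_iota add1n ltnS => /andP[k1 kn] ->.
  by exists k.
move=> /circle_gapsP[y /ptsP[k [_ _ ->]]|]; first exact: frac_part_itv.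
move=> a [b [-> ab /ptsP[k [k0 kn aE]] bE next]].
exists a; split; first by rewrite subr_gt0.
  have [k' [l [k'0 k'n ->]]] : exists (k' : nat) (l : int),
    [/\ (0 < k')%N, (k' <= n)%N & b = k'%:R * z - l%:~R].
    case: bE => [/ptsP[k' [? ? ->]]|[_ /ptsP[k' [? ? ->]] ->]].
      by exists k', (Num.floor (k'%:R * z)).
    exists k', (Num.floor (k'%:R * z) - 1); split => //.
    by rewrite /frac_part intrB; ring.
  exists (k'%:Z - k%:Z), (l - Num.floor (k%:R * z)); split; first lia.
  by rewrite aE /frac_part !intrB; ring.
move=> h l h0 hn ah; rewrite lerD2r.
have hin : kronecker z h \in [seq kronecker z k | k <- iota 1 n].
  by apply: map_f; rewrite mem_iota h0 add1n ltnS.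
have [next0 next1] := next _ hin.
have /andP[a0 _] := frac_part_itv (k%:R * z); rewrite -aE in a0.
have /andP[f0 f1] := frac_part_itv (h%:R * z).
have hE : h%:R * z - l%:~R = kronecker z h + (Num.floor (h%:R * z) - l)%:~R.
  by rewrite intrB /kronecker /frac_part; ring.
rewrite hE in ah *; set m := _ - l in ah *.
(* [m] counts the turns from the point to its translate; it is nonnegative as
   the translate lies to the right of [a >= 0]. *)
have : -1 < m.
  by rewrite -(ltr_int R) intrN; rewrite /kronecker in ah; lra.
have [m0|m0|m0] := ltgtP m 0; first by lia.
  move=> _; apply: (le_trans next1); rewrite lerD2l.
  by rewrite (ler_int R 1) -gtz0_ge1.
by rewrite m0 addr0 in ah *; move=> _; apply: next0.
Qed.

(** * The order of magnitude of the gaps, and the obstructions *)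

Lemma powR_unbounded {R : realType} (N : nat -> nat) (b K : R) :
  (forall i j : nat, (i < j)%N -> (N i < N j)%N) -> 0 < b ->
  exists i, K < (N i)%:R `^ b.
Proof.
move=> Nincr b0.
have Ni i : (i <= N i)%N.
  by elim: i => // i IHi; apply: leq_ltn_trans IHi (Nincr _ _ (ltnSn i)).
pose M : R := `|K| + 1.
have M0 : 0 <= M by rewrite addr_ge0.
pose i := Num.bound (M `^ b^-1).
have Mi : M `^ b^-1 <= (N i)%:R.
  apply: (@le_trans _ _ i%:R); last by rewrite ler_nat.
  by apply/ltW/archi_boundP/powR_ge0.
exists i; apply: (@lt_le_trans _ _ M).
  by have := ler_norm K; rewrite /M; lra.
have -> : M = (M `^ b^-1) `^ b by rewrite -powRrM mulVf ?powRr1// lt0r_neq0.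
by rewrite (ge0_ler_powR (ltW b0) _ _ Mi)// nnegrE ?powR_ge0.
Qed.

(** The first alternative is the rational case, the second the quadratic one. *)
Lemma kronecker_gap_bounds {R : realType} (z : R) (d : nat) :
  algebraic_of_degree z d -> (d <= 2)%N ->
  exists2 c : R, 0 < c &
    (forall n j : nat, (0 < n)%N ->
       (j < size (gap_lengths (kronecker z) n))%N ->
       c <= gap_length (kronecker z) n j) \/
    (exists C : R, forall n j : nat, (0 < n)%N ->
       (j < size (gap_lengths (kronecker z) n))%N ->
       c / n%:R <= gap_length (kronecker z) n j <= C / n%:R).
Proof.
move=> hz hd; have [[c c0 zc]|[c c0 zc]] := algebraic_approximation z d hz hd.
  exists c => //; left=> n j n0 /gap_kronecker[_ [g0 [m [l [_ gE]]] _]].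
  have := zc m l; rewrite -gE gtr0_norm//; apply.
  by rewrite gt_eqF.
exists (Num.min c 1); first by rewrite lt_min c0 ltr01.
right; exists (2 + c^-1) => n j n0 /gap_kronecker[a [g0 [m [l [mn gE]]] next]].
have n0R : 0 < n%:R :> R by rewrite ltr0n.
apply/andP; split; last first.
  have [k [h [k0 kn ak ka]]] := kronecker_relatively_dense z c c0 zc n a n0.
  by apply: le_trans (next k h k0 kn ak) _; lra.
have [m0|m0] := eqVneq m 0.
  (* The gap is a positive integer, whence the minimum with 1 above. *)
  have l1 : 1 <= gap_length (kronecker z) n j.
    move: g0; rewrite gE m0 mul0r add0r -intrN ltr0z gtz0_ge1.
    by rewrite -(ler_int R).
  apply: le_trans l1; rewrite ler_pdivrMr// mul1r.
  by apply: (@le_trans _ _ 1); rewrite ?ge_min ?lexx ?orbT// ler1n.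
apply: le_trans (_ : c / n%:R <= _).
  by rewrite ler_pM2r ?invr_gt0// ge_min lexx.
by have := zc n m l m0 mn; rewrite -gE gtr0_norm.
Qed.

Theorem proposition1p8 (R : realType) (z alpha : R) (d : nat)
  (hz : algebraic_of_degree z d) (hd : (d <= 2)%N)
  (halpha0 : 0 < alpha) (halpha1 : alpha < 1)
  (N : nat -> nat) (s : nat)
  (hNpos : forall i : nat, (0 < N i)%N)
  (hNincr : forall i j : nat, (i < j)%N -> (N i < N j)%N)
  (hs : forall i : nat, size (gap_lengths (kronecker z) (N i)) = s)
  (hclass : forall j : nat, (j < s)%N ->
     [\/ gap_small (kronecker z) N alpha j,
         gap_intermediate (kronecker z) N alpha j
       | gap_large (kronecker z) N alpha j]) :
  ~ obstruction1 (kronecker z) N alpha s /\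
  ~ obstruction2 (kronecker z) N alpha s.
Proof.
have [c c0 gapP] := kronecker_gap_bounds z d hz hd.
have N0 i : 0 < (N i)%:R :> R by rewrite ltr0n.
split.
  move=> [j js [K1 [K2 [K10 K20 gK]]]].
  case: gapP => [gapP|[C gapP]].
    have [i] := powR_unbounded N alpha (K2 / c) hNincr halpha0.
    apply/negP; rewrite -leNgt ler_pdivlMr// -ler_pdivlMl ?powR_gt0//.
    rewrite mulrC; apply: le_trans (gK i).2.
    by apply: gapP; rewrite ?hs.
  have a1 : 0 < 1 - alpha by rewrite subr_gt0.
  have [i] := powR_unbounded N (1 - alpha) (C / K1) hNincr a1.
  apply/negP; rewrite -leNgt ler_pdivlMr// powRD ?gt_eqF ?implybT//.
  rewrite powRr1 ?(ltW (N0 i))// powRN -mulrA -ler_pdivlMl//.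
  rewrite [leRHS]mulrC [_^-1 * _]mulrC.
  apply: le_trans (gK i).1 _.
  by have := gapP (N i) j (hNpos i); rewrite hs => /(_ js)/andP[].
move=> [w [ws _ _ small]].
have {}gapP i : c <= (N i)%:R * gap_length (kronecker z) (N i) w.
  have wi : (w < size (gap_lengths (kronecker z) (N i)))%N by rewrite hs.
  case: gapP => [/(_ _ _ (hNpos i) wi) cg|[C /(_ _ _ (hNpos i) wi)]].
    rewrite -[c]mul1r; apply: ler_pM => //; first exact: ltW.
    by rewrite ler1n.
  by move=> /andP[+ _]; rewrite ler_pdivrMr// mulrC.
have [i _ /(_ i (leqnn i))] := cvgr_lt _ small c c0.
by apply/negP; rewrite -leNgt powRr1 ?(ltW (N0 i)).
Qed.
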